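(* Let $S$ be a $\mathrm{Cu}$-semigroup and let $n\in\mathbb{N}$. Then the following are equivalent: (1) $\dim(S)\leq n$; (2) every finite subset of $S$ is contained in a countably based sub-$\mathrm{Cu}$-semigroup $T\subseteq S$ satisfying $\dim(T)\leq n$; (3) every countable subset of $S$ is contained in a countably based sub-$\mathrm{Cu}$-semigroup $T\subseteq S$ satisfying $\dim(T)\leq n$.
   Context: Way-below relation: in a partially ordered set, $x\ll y$ means that for every increasing sequence $(z_n)_n$ that has a supremum $z$ with $y\leq z$ there exists $n$ with $x\leq z_n$. A $\mathrm{Cu}$-semigroup is an abelian monoid $S$ with a partial order such that $0\leq x$ for all $x$, and $x\leq y$ implies $x+z\leq y+z$, satisfying: (O1) every increasing sequence has a supremum; (O2) every element is the supremum of a $\ll$-increasing sequence (i.e. $x_n\ll x_{n+1}$ for all $n$); (O3) $x'\ll x$ and $y'\ll y$ imply $x'+y'\ll x+y$; (O4) $\sup_n x_n+\sup_n y_n=\sup_n(x_n+y_n)$ for increasing sequences $(x_n)_n,(y_n)_n$. A $\mathrm{Cu}$-morphism is an order-preserving monoid morphism between $\mathrm{Cu}$-semigroups that preserves suprema of increasing sequences and the way-below relation. A submonoid $T\subseteq S$ is a sub-$\mathrm{Cu}$-semigroup if $T$ is a $\mathrm{Cu}$-semigroup with respect to the order induced by $S$ and the inclusion map $T\to S$ is a $\mathrm{Cu}$-morphism. A subset $B\subseteq S$ is a basis if for all $x',x\in S$ with $x'\ll x$ there exists $y\in B$ with $x'\ll y\ll x$; $S$ is countably based if it has a countable basis. Dimension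 (with $\mathbb{N}=\{0,1,2,\ldots\}$): for a $\mathrm{Cu}$-semigroup $S$ and $n\in\mathbb{N}$, write $\dim(S)\leq n$ if, whenever $x'\ll x\ll y_1+\ldots+y_r$ in $S$, there exist $z_{j,k}\in S$ for $j=1,\ldots,r$ and $k=0,\ldots,n$ such that (i) $z_{j,k}\ll y_j$ for all $j,k$; (ii) $x'\ll\sum_{j,k}z_{j,k}$; (iii) $\sum_{j=1}^r z_{j,k}\ll x$ for each $k=0,\ldots,n$. Then $\dim(S)$ is the smallest such $n$, and $\dim(S)=\infty$ if no such $n$ exists. *)

(* Defs.v *)
From HB Require Import structures.
From mathcomp Require Import all_boot all_order all_algebra.
From mathcomp Require Import all_classical.

Set Implicit Arguments.
Unset Strict Implicit.
Unset Printing Implicit Defensive.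

Import Order.TTheory GRing.Theory.

Local Open Scope classical_set_scope.
Local Open Scope ring_scope.

(* Positively ordered monoids. The order is a field here, and not inherited
   from porderType, because MathComp already fixes the join of porderType with
   the additive structures to be porderZmodType, a structure with opposites;
   the porderType instance comes right after. For the same reason, the notation
   [(_ <= _)%O] does not elaborate on sums unless they are cast to S. *)
HB.mixin Record isPOM S of GRing.Nmodule S := {
  pom_le : rel S;
  pom_le_refl : reflexive pom_le;
  pom_le_anti : antisymmetric pom_le;
  pom_le_trans : transitive pom_le;
  pom_le0 : forall x : S, pom_le 0 x;
  pom_leD2r : forall x y z : S, pom_le x y -> pom_le (x + z) (y + z)
}.

#[short(type="pomType")]
HB.structure Definition POM := { S of GRing.Nmodule S & isPOM S }.

Fact pom_display : Order.disp_t. Proof. exact: (Order.Disp tt tt). Qed.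

HB.instance Definition _ (S : pomType) :=
  Order.Le_isPOrder.Build pom_display (S : Type)
    (@pom_le_refl S) (@pom_le_anti S) (@pom_le_trans S).

Definition increasing (S : pomType) (z : nat -> S) : Prop :=
  {homo z : m n / (m <= n)%N >-> (m <= n)%O}.

Definition is_sup (S : pomType) (z : nat -> S) (s : S) : Prop :=
  supremums (range z) s.

Definition way_below (S : pomType) (x y : S) : Prop :=
  forall (z : nat -> S) (s : S),
    increasing z -> is_sup z s -> (y <= s)%O -> exists n, (x <= z n)%O.

Notation "x ≪ y" := (way_below x y) (at level 70, no associativity).

Record cu_semigroup (S : pomType) : Prop := CuSemigroup {
  cu_O1 : forall z : nat -> S, increasing z -> exists s, is_sup z s;
  cu_O2 : forall x : S,
    exists2 z : nat -> S, (forall n, z n ≪ z n.+1) & is_sup z x;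
  cu_O3 : forall x' x y' y : S, x' ≪ x -> y' ≪ y -> x' + y' ≪ x + y;
  cu_O4 : forall (x y : nat -> S) (s t : S), increasing x -> increasing y ->
    is_sup x s -> is_sup y t -> is_sup (fun n => x n + y n) (s + t)
}.

Record cu_morphism (S S' : pomType) (f : S -> S') : Prop := CuMorphism {
  cu_morphism_dom : cu_semigroup S;
  cu_morphism_cod : cu_semigroup S';
  cu_morphism_nmod : nmod_morphism f;
  cu_morphism_le : forall x y : S, (x <= y)%O -> (f x <= f y)%O;
  cu_morphism_sup : forall (z : nat -> S) (s : S),
    increasing z -> is_sup z s -> is_sup (f \o z) (f s);
  cu_morphism_way_below : forall x y : S, x ≪ y -> f x ≪ f y
}.

(* The submonoids of S are the T : addrClosed S, i.e., the predicates on S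
   that contain 0 and are closed under +; [submonoid T] is the carrier of T,
   with the addition and the order induced by S. *)
Record submonoid (S : pomType) (T : addrClosed S) : Type :=
  Submonoid { submonoid_val : S; _ : submonoid_val \in T }.

Section SubmonoidOrder.
Variables (S : pomType) (T : addrClosed S).

HB.instance Definition _ := [isSub for @submonoid_val S T].
HB.instance Definition _ := [Choice of submonoid T by <:].
HB.instance Definition _ :=
  GRing.SubChoice_isSubNmodule.Build S _ (submonoid T) (rpred0D T).

Let le : rel (submonoid T) := fun x y => (val x <= val y)%O.

Let le_refl : reflexive le. Proof. by move=> x; exact: lexx. Qed.

Let le_anti : antisymmetric le.
Proof. by move=> x y xy; apply/val_inj/le_anti. Qed.

Let le_trans : transitive le.
Proof. by move=> x y z; exact: le_trans. Qed.

Let le0 (x : submonoid T) : le 0 x.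
Proof. exact: (pom_le0 (val x)). Qed.

Let leD2r (x y z : submonoid T) : le x y -> le (x + z) (y + z).
Proof. exact: pom_leD2r. Qed.

HB.instance Definition _ :=
  isPOM.Build (submonoid T) le_refl le_anti le_trans le0 leD2r.

End SubmonoidOrder.

Definition sub_cu_semigroup (S : pomType) (T : addrClosed S) : Prop :=
  cu_semigroup (submonoid T) /\ cu_morphism (@submonoid_val S T).

Definition is_basis (S : pomType) (B : set S) : Prop :=
  forall x' x : S, x' ≪ x -> exists2 y, B y & x' ≪ y /\ y ≪ x.

Definition countably_based (S : pomType) : Prop :=
  exists2 B : set S, countable B & is_basis B.

Definition dim_le (S : pomType) (n : nat) : Prop :=
  forall (x' x : S) (r : nat) (y : 'I_r -> S),
    x' ≪ x -> x ≪ \sum_(j < r) y j ->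
    exists z : 'I_r -> 'I_n.+1 -> S,
      [/\ forall j k, z j k ≪ y j,
          x' ≪ \sum_(j < r) \sum_(k < n.+1) z j k &
          forall k, \sum_(j < r) z j k ≪ x].

(* Main.v *)
Require Import Defs.
From HB Require Import structures.
From mathcomp Require Import all_boot all_order all_algebra.
From mathcomp Require Import all_classical.

(** The theorem is a downward Loewenheim-Skolem argument.

    The way-below relation of a sub-Cu-semigroup T is the restriction of that
    of S ([sub_way_below]), so a witness for the dimension condition found in T
    is a witness in S. The condition for S concerns finitely many elements at a
    time; hence it holds as soon as every finite subset of S lies in some T of
    dimension at most n ([dim_le_of_sub]). A finite set being countable, this
    gives both implications that end in a statement on S.

    Conversely, let dim S be at most n and A be countable. Closing A under
    finite sums, under the choice of a way-below-increasing sequence converging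
    to each element, and under the choice of witnesses z_(j,k) for each
    instance x' ≪ x ≪ y_1 + ... + y_r of the dimension condition, gives a
    countable set C ([countable_core]): the choices are countably many finitary
    operations. C is not closed under suprema, so let T be the set of x in S
    such that any x' ≪ x can be separated from x by an element y of C, that is,
    x' ≪ y ≪ x ([approximable]). Then T is the set of suprema of
    way-below-increasing sequences of C; it contains C, it is a
    sub-Cu-semigroup ([span_sub_cu_semigroup]), and C is a basis of it by the
    very definition. An instance of the dimension condition in T can be pushed
    strictly inside C before a witness is looked up there, because the condition
    leaves room at x', at x and at each y_j ([span_dim_le]). *)

Local Open Scope classical_set_scope.

Set Implicit Arguments.
Unset Strict Implicit.
Unset Printing Implicit Defensive.

Import Order.TTheory GRing.Theory.

Local Open Scope ring_scope.

(** * Countable sets closed under countably many operations *)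

Lemma countableU (T : Type) (A B : set T) :
  countable A -> countable B -> countable (A `|` B).
Proof.
move=> cA cB.
have -> : A `|` B = \bigcup_(b in [set: bool]) (if b then A else B).
  apply/seteqP; split=> [x [Ax|Bx]|x [[] _ ?]].
  - by exists true.
  - by exists false.
  - by left.
  - by right.
by apply: bigcup_countable => // -[].
Qed.

Lemma countable_range (I : countType) (T : Type) (f : I -> T) :
  countable (range f).
Proof. exact: sub_countable (card_image_le f setT) (countableP _). Qed.

Lemma countable_enum (T : Type) (x0 : T) (A : set T) :
  countable A -> exists e : nat -> T, A `<=` range e.
Proof.
move=> /countable_injP[f f_inj].
have /choice[e eP] : forall n, exists x, forall y, A y -> f y = n -> x = y.
  move=> n; have [[y [Ay fy]]|nA] := pselect (exists y, A y /\ f y = n).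
    by exists y => z Az fz; apply: f_inj; rewrite ?inE // fy fz.
  by exists x0 => y Ay fy; case: nA; exists y.
by exists e => x Ax; exists (f x) => //; exact: eP.
Qed.

(** Value of a term over operations of variable arity indexed by [nat]. The
    leaves are only a dummy: constants are the nodes without arguments. *)
Fixpoint eval_tree (T : Type) (x0 : T) (op : nat -> seq T -> T)
    (t : GenTree.tree unit) : T :=
  match t with
  | GenTree.Leaf _ => x0
  | GenTree.Node i l => op i (map (eval_tree x0 op) l)
  end.

(** The closure is the set of values of all terms over the operations that
    enumerate the sets [F s]; it is countable since there are countably many
    terms. A set to be contained in [C] is provided through [F [::]]. *)
Lemma countable_closure (T : choiceType) (x0 : T) (F : seq T -> set T) :
  (forall s, countable (F s)) ->
  exists2 C : set T, countable C &
    forall s, (forall x, x \in s -> C x) -> F s `<=` C.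
Proof.
move=> cF.
have /choice[e eP] : forall s, exists e : nat -> T, F s `<=` range e.
  by move=> s; exact: countable_enum.
pose ev := eval_tree x0 (fun i s => e s i).
exists (range ev); first exact: countable_range.
move=> s Cs x /eP[i _ <-].
suff [l <-] : exists l, map ev l = s by exists (GenTree.Node i l).
elim: s Cs => [|y s IHs] Cs; first by exists [::].
have [t _ ty] := Cs y (mem_head _ _).
have [|l ls] := IHs; first by move=> z zs; apply: Cs; rewrite inE zs orbT.
by exists (t :: l); rewrite /= ty ls.
Qed.

(** * The way-below relation *)

Section WayBelow.
Variable S : pomType.
Implicit Types (x y z : S) (u : nat -> S).

Lemma is_supP u x :
  is_sup u x <-> (forall n, (u n <= x)%O) /\
                 (forall y, (forall n, (u n <= y)%O) -> (x <= y)%O).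
Proof.
split=> [[ux xmin]|[ux xmin]]; split.
- by move=> n; apply: ux; exists n.
- by move=> y uy; apply: xmin => _ [n _ <-].
- by move=> _ [n _ <-].
- by move=> y uy; apply: xmin => n; apply: uy; exists n.
Qed.

Lemma is_sup_uniq u x y : is_sup u x -> is_sup u y -> x = y.
Proof.
move=> /is_supP[ux xmin] /is_supP[uy ymin].
by apply: le_anti; rewrite xmin // ymin.
Qed.

Lemma pom_leD (x1 y1 x2 y2 : S) :
  (x1 <= y1)%O -> (x2 <= y2)%O -> (x1 + x2 <= y1 + y2 :> S)%O.
Proof.
move=> le1 le2; apply: (@le_trans _ _ (y1 + x2 : S)); first exact: pom_leD2r.
by rewrite ![y1 + _]addrC; exact: pom_leD2r.
Qed.

Lemma increasingP u : (forall n, (u n <= u n.+1)%O) -> increasing u.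
Proof. by move=> uS; exact: homo_leq (@lexx _ _) (@le_trans _ _) uS. Qed.

Lemma way_below_le x y : x ≪ y -> (x <= y)%O.
Proof.
move=> /(_ (fun=> y) y)[] //; by apply/is_supP; split=> // z /(_ 0%N).
Qed.

Lemma le_way_below_trans x y z : (x <= y)%O -> y ≪ z -> x ≪ z.
Proof.
move=> xy yz u s uinc us zs; have [n yn] := yz u s uinc us zs.
by exists n; exact: le_trans yn.
Qed.

Lemma way_below_le_trans x y z : x ≪ y -> (y <= z)%O -> x ≪ z.
Proof.
by move=> xy yz u s uinc us zs; apply: xy us _ => //; exact: le_trans zs.
Qed.

Lemma way_below_trans x y z : x ≪ y -> y ≪ z -> x ≪ z.
Proof. by move=> /way_below_le; exact: le_way_below_trans. Qed.

Lemma way_below0 : (0 : S) ≪ 0.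
Proof. by move=> u s _ _ _; exists 0%N; exact: pom_le0. Qed.

Lemma way_below_seq_increasing u : (forall n, u n ≪ u n.+1) -> increasing u.
Proof. by move=> uS; apply: increasingP => n; exact: way_below_le. Qed.

Lemma way_below_seq_sup u x :
  (forall n, u n ≪ u n.+1) -> is_sup u x -> forall n, u n ≪ x.
Proof. by move=> uS /is_supP[ux _] n; exact: way_below_le_trans (uS n) (ux _). Qed.

Lemma increasing_sum (I : Type) (r : seq I) (u : I -> nat -> S) :
  (forall i, increasing (u i)) -> increasing (fun n => \sum_(i <- r) u i n).
Proof.
move=> uinc m n mn; apply: (big_ind2 (fun x y : S => (x <= y)%O)) => // [|i _].
  exact: pom_leD.
exact: uinc.
Qed.

(** Axiom (O4) for finite families, which reduces the approximation of a sum
    to that of its terms. *)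
Lemma is_sup_sum (I : Type) (r : seq I) (u : I -> nat -> S) (x : I -> S) :
  cu_semigroup S -> (forall i, increasing (u i)) ->
  (forall i, is_sup (u i) (x i)) ->
  is_sup (fun n => \sum_(i <- r) u i n) (\sum_(i <- r) x i).
Proof.
move=> hS uinc ux; elim: r => [|i r IHr].
  rewrite big_nil; apply/is_supP; split=> [n|y /(_ 0%N)]; by rewrite big_nil.
rewrite big_cons; under [X in is_sup X]eq_fun do rewrite big_cons.
by apply: cu_O4 => //; exact: increasing_sum.
Qed.

Lemma way_below_sum (I : Type) (r : seq I) (x y : I -> S) :
  cu_semigroup S -> (forall i, x i ≪ y i) ->
  \sum_(i <- r) x i ≪ \sum_(i <- r) y i.
Proof.
move=> hS xy; apply: (big_ind2 (@way_below S)) => //; first exact: way_below0.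
by move=> ? ? ? ?; exact: cu_O3.
Qed.

(** When [C] consists of approximable elements, these [x] form the closure of
    [C] under suprema of increasing sequences. Unlike a formulation with
    sequences, this one is stable under suprema without a diagonal argument:
    see [approximable_sup]. *)
Definition approximable (C : set S) x : Prop :=
  forall x', x' ≪ x -> exists2 y, C y & x' ≪ y /\ y ≪ x.

Lemma sub_approximable (C D : set S) x :
  C `<=` D -> approximable C x -> approximable D x.
Proof. by move=> CD Cx x' /Cx[y Cy xyx]; exists y => //; exact: CD. Qed.

Hypothesis hS : cu_semigroup S.

Lemma way_below_seq_approximable (C : set S) u x :
  (forall n, C (u n)) -> (forall n, u n ≪ u n.+1) -> is_sup u x ->
  approximable C x.
Proof.
move=> Cu uS ux x' x'x.
have [n x'n] := x'x u x (way_below_seq_increasing uS) ux (lexx x).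
exists (u n.+1) => //; split; first exact: le_way_below_trans x'n (uS n).
exact: way_below_seq_sup.
Qed.

Lemma interpolation x : approximable setT x.
Proof. by have [u uS ux] := cu_O2 hS x; exact: way_below_seq_approximable ux. Qed.

(** Starting from a way-below-increasing sequence [v] of [S] with supremum [x],
    the terms are chosen one after the other: the next one must lie above the
    current one, to get a way-below-increasing sequence, and above the current
    term of [v], to have [x] as supremum. Both bounds are way below [x], hence
    below a common term of [v], above which [C] has an element. *)
Lemma approximable_seq (C : set S) x : approximable C x ->
  exists u : nat -> S,
    [/\ forall n, C (u n), forall n, u n ≪ u n.+1 & is_sup u x].
Proof.
move=> Cx; have [v vS vx] := cu_O2 hS x.
have vinc := way_below_seq_increasing vS; have v_lt := way_below_seq_sup vS vx.
pose D : Type := {y | C y /\ y ≪ x}.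
have step (n : nat) (d : D) : exists d' : D,
    sval d ≪ sval d' /\ (v n <= sval d')%O.
  case: d => y [Cy yx] /=; have [m ym] := yx v x vinc vx (lexx x).
  have [z Cz [vz zx]] := Cx _ (v_lt (maxn n m)).
  exists (exist _ z (conj Cz zx)) => /=; split.
    by apply: le_way_below_trans vz; apply: le_trans ym _; apply/vinc/leq_maxr.
  by apply: le_trans (way_below_le vz); apply/vinc/leq_maxl.
(* The index is part of the state, so that a single choice function serves all
   the steps. *)
have /choice[next nextP] : forall nd : nat * D, exists d' : D,
    sval nd.2 ≪ sval d' /\ (v nd.1 <= sval d')%O by case=> n d; exact: step.
have [y0 Cy0 [_ y0x]] := Cx _ (v_lt 0%N).
pose w := fix w n : D :=
  if n is m.+1 then next (m, w m) else exist _ y0 (conj Cy0 y0x).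
exists (fun n => sval (w n)); split=> [n|n|].
- by case: (w n) => y [].
- by have [] := nextP (n, w n).
- apply/is_supP; split=> [n|y wy].
    by case: (w n) => z [Cz zx]; exact: way_below_le.
  have /is_supP[_ xmin] := vx; apply: xmin => n.
  by apply: le_trans (wy n.+1); have [] := nextP (n, w n).
Qed.

(** If [x' ≪ y ≪ x], then [y] is below some [u n], so that [x' ≪ u n] and the
    approximation can be made there. *)
Lemma approximable_sup (C : set S) u x :
  increasing u -> (forall n, approximable C (u n)) -> is_sup u x ->
  approximable C x.
Proof.
move=> uinc Cu ux x' /interpolation[y _ [x'y yx]].
have [n yn] := yx u x uinc ux (lexx x).
have [z Cz [x'z zu]] := Cu n _ (way_below_le_trans x'y yn).
exists z => //; split=> //; apply: way_below_le_trans zu _.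
by have /is_supP[] := ux.
Qed.

(** Each [y j] is the supremum of a way-below-increasing sequence of [C]; by
    (O4), [x] lies below the sum of their terms of some common rank, and the
    next rank makes the relation strict. *)
Lemma approximable_sum (C : set S) (r : nat) (y : 'I_r -> S) x :
  (forall j, approximable C (y j)) -> x ≪ \sum_(j < r) y j ->
  exists b : 'I_r -> S, [/\ forall j, C (b j), forall j, b j ≪ y j &
    x ≪ \sum_(j < r) b j].
Proof.
move=> Cy xy.
have /choice[u uP] : forall j, exists u : nat -> S,
    [/\ forall n, C (u n), forall n, u n ≪ u n.+1 & is_sup u (y j)].
  by move=> j; exact: approximable_seq.
have uinc j : increasing (u j).
  by apply: way_below_seq_increasing; have [] := uP j.
have [n xn] : exists n, (x <= \sum_(j < r) u j n)%O.
  apply: xy (lexx _).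
    exact: increasing_sum.
  by apply: is_sup_sum => // j; have [] := uP j.
exists (fun j => u j n.+1); split=> [j|j|].
- by have [] := uP j.
- by have [_ uS uy] := uP j; exact: (way_below_seq_sup uS uy).
apply: le_way_below_trans xn _; apply: way_below_sum => // j.
by have [] := uP j.
Qed.

End WayBelow.


(** * Sub-Cu-semigroups generated by an approximating subset *)

Section SubCu.
Variables (S : pomType) (T : addrClosed S).
Implicit Types (x y : submonoid T) (u : nat -> submonoid T).

Lemma val_sum (r : nat) (y : 'I_r -> submonoid T) :
  val (\sum_(j < r) y j) = \sum_(j < r) val (y j).
Proof. exact: (big_morph val (fun _ _ => erefl) erefl). Qed.

(** One direction is part of the definition of a sub-Cu-semigroup; the other
    holds because suprema in [T] remain suprema in [S], so that [T] has fewer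
    sequences to test the relation against. *)
Lemma sub_way_below x y : sub_cu_semigroup T -> x ≪ y <-> val x ≪ val y.
Proof.
case=> _ [_ _ _ _ val_sup val_wb]; split=> [|xy]; first exact: val_wb.
by move=> u s uinc us ys; apply: (xy (val \o u) (val s)) => //; exact: val_sup.
Qed.

(** The two hypotheses on [T] below are a criterion for it to be a sub-Cu-semigroup:
    the first one makes suprema in [T] agree with those in [S], and the second
    one supplies the sequences of (O2), from which the agreement of the
    way-below relations follows. *)

Hypothesis hS : cu_semigroup S.
Hypothesis T_sup : forall (u : nat -> S) (s : S), increasing u ->
  (forall n, u n \in T) -> is_sup u s -> s \in T.
Hypothesis T_approx : forall s : S, s \in T -> approximable [set` T] s.

Lemma val_increasing u : increasing u -> increasing (val \o u).
Proof. by []. Qed.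

Lemma is_sup_val u x : is_sup (val \o u) (val x) -> is_sup u x.
Proof.
move=> /is_supP[ux xmin]; apply/is_supP; split=> [n|y uy]; first exact: ux.
by apply: xmin => n; exact: uy.
Qed.

Lemma submonoid_sup u : increasing u ->
  exists x, is_sup (val \o u) (val x).
Proof.
move=> uinc; have [s us] := cu_O1 hS (val_increasing uinc).
have Ts : s \in T by apply: T_sup us => // n; exact: valP (u n).
by exists (Sub s Ts); rewrite SubK.
Qed.

Lemma val_is_sup u x : increasing u -> is_sup u x -> is_sup (val \o u) (val x).
Proof.
move=> uinc ux; have [y uy] := submonoid_sup uinc.
by rewrite (is_sup_uniq ux (is_sup_val uy)).
Qed.

(** If [x] is way below [y] in [T], test this against a sequence [u] of [T],
    way-below-increasing in [S], with supremum [y]: then [x <= u n ≪ y]. *)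
Lemma val_way_below x y : x ≪ y <-> val x ≪ val y.
Proof.
split=> [xy|xy u s uinc us ys]; last first.
  by apply: (xy (val \o u) (val s)) => //; exact: val_is_sup.
have [u [Tu uS uy]] := approximable_seq hS (T_approx (valP y)).
pose v n : submonoid T := Sub (u n) (Tu n).
have vinc : increasing v.
  by move=> m n mn; exact: (way_below_seq_increasing uS).
have [n xn] : exists n, (val x <= u n)%O.
  by apply: (xy v y vinc) (lexx _); exact: is_sup_val.
exact: le_way_below_trans xn (way_below_seq_sup uS uy n).
Qed.

Lemma cu_semigroup_submonoid : cu_semigroup (submonoid T).
Proof.
split.
- by move=> u /submonoid_sup[x /is_sup_val]; exists x.
- move=> x; have [u [Tu uS ux]] := approximable_seq hS (T_approx (valP x)).
  exists (fun n => Sub (u n) (Tu n)); last exact: is_sup_val.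
  by move=> n; apply/val_way_below; exact: uS.
- move=> x' x y' y /val_way_below x'x /val_way_below y'y.
  by apply/val_way_below; exact: cu_O3.
- move=> u v x y uinc vinc /(val_is_sup uinc) ux /(val_is_sup vinc) vy.
  by apply: is_sup_val; exact: (cu_O4 hS).
Qed.

Lemma sub_cu_semigroup_of_approximable : sub_cu_semigroup T.
Proof.
split; first exact: cu_semigroup_submonoid.
split=> //; first exact: cu_semigroup_submonoid.
- by move=> u s; exact: val_is_sup.
- by move=> x y /val_way_below.
Qed.

End SubCu.

(** * Descent of the dimension bound from a sub-Cu-semigroup *)

(** It suffices that [T] contain the elements [x'], [x] and [y j] of one
    instance of the condition. *)
Lemma dim_le_of_sub (S : pomType) (n : nat) :
  (forall A : set S, finite_set A ->
     exists T : addrClosed S,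
       [/\ sub_cu_semigroup T, countably_based (submonoid T),
           A `<=` [set` T] & dim_le (submonoid T) n]) ->
  dim_le S n.
Proof.
move=> subS x' x r y x'x xy.
have [|T [hT _ AT dimT]] := subS ([set x'; x] `|` range y).
  by rewrite finite_setU; split=> //; exact: finite_image.
have Tx' : x' \in T by apply: AT; left; left.
have Tx : x \in T by apply: AT; left; right.
have Ty j : y j \in T by apply: AT; right; exists j.
have [||z [zy x'z zx]] :=
    dimT (Sub x' Tx') (Sub x Tx) r (fun j => Sub (y j) (Ty j)).
- exact/(sub_way_below _ _ hT).
- by apply/(sub_way_below _ _ hT); rewrite val_sum.
exists (fun j k => val (z j k)); split=> [j k||k].
- by have /(sub_way_below _ _ hT) := zy j k.
- have /(sub_way_below _ _ hT) := x'z; rewrite val_sum.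
  by under eq_bigr do rewrite val_sum.
- by have /(sub_way_below _ _ hT) := zx k; rewrite val_sum.
Qed.

(** * A countable core for the dimension condition *)

Definition decomposition (S : pomType) (r n : nat) (x' x : S) (y : 'I_r -> S)
    (z : 'I_r -> 'I_n -> S) : Prop :=
  [/\ forall j k, z j k ≪ y j,
      x' ≪ \sum_(j < r) \sum_(k < n) z j k &
      forall k, \sum_(j < r) z j k ≪ x].

(** The dimension condition for data in [C] and witnesses in [C], the way-below
    relation being that of [S]. *)
Definition dim_le_on (S : pomType) (C : set S) (n : nat) : Prop :=
  forall (x' x : S) (r : nat) (y : 'I_r -> S),
    C x' -> C x -> (forall j, C (y j)) ->
    x' ≪ x -> x ≪ \sum_(j < r) y j ->
    exists2 z : 'I_r -> 'I_n.+1 -> S,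
      forall j k, C (z j k) & decomposition x' x y z.

(** An instance of the dimension condition is coded by a list, so as to become
    an argument of a finitary operation of [countable_closure]. *)
Lemma dim_witness (S : pomType) (n : nat) (s : seq S) : dim_le S n ->
  exists W : set S, countable W /\
    forall (x' x : S) (r : nat) (y : 'I_r -> S), s = [:: x', x & codom y] ->
    x' ≪ x -> x ≪ \sum_(j < r) y j ->
    exists2 z : 'I_r -> 'I_n.+1 -> S,
      forall j k, W (z j k) & decomposition x' x y z.
Proof.
move=> dimS.
have [[[[x' x] [r y]] /= [-> x'x xy]]|none] :=
    pselect (exists d : S * S * {r : nat & 'I_r -> S},
      let: (x', x, existT r y) := d in
      [/\ s = [:: x', x & codom y], x' ≪ x & x ≪ \sum_(j < r) y j]); last first.
  exists set0; split=> // x' x r y sE x'x xy; case: none.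
  by exists (x', x, existT _ r y).
have [z zP] := dimS _ _ _ _ x'x xy.
exists (range (fun jk => z jk.1 jk.2)); split; first exact: countable_range.
(* The list determines the instance, including its length [r]. *)
move=> a' a r2 y2 [<- <- E] _ _.
have Er : r = r2.
  by rewrite -(card_ord r) -(card_ord r2) -(size_codom y) E size_codom.
subst r2; have <- : y = y2.
  apply/funext => j; have := congr1 (nth 0 ^~ (enum_rank j)) E.
  by rewrite !nth_codom !enum_rankK.
by exists z => // j k; exists (j, k).
Qed.

(** [C] is closed under one multivalued operation on lists, which combines the
    set [A], finite sums, the sequences of (O2) for the head of the list, and
    the witnesses of [dim_witness]. *)
Lemma countable_core (S : pomType) (n : nat) (A : set S) :
  cu_semigroup S -> dim_le S n -> countable A ->
  exists C : set S,
    [/\ countable C /\ A `<=` C, C 0 /\ (forall x y, C x -> C y -> C (x + y)),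
        forall x, C x -> approximable C x & dim_le_on C n].
Proof.
move=> hS dimS cA.
have /choice[u uP] : forall x : S, exists u : nat -> S,
    (forall m, u m ≪ u m.+1) /\ is_sup u x.
  by move=> x; have [u uS ux] := cu_O2 hS x; exists u.
have /choice[W WP] := fun s : seq S => dim_witness s dimS.
pose F s : set S :=
  A `|` [set \sum_(x <- s) x] `|` range (u (head 0 s)) `|` W s.
have [|C cC CF] := @countable_closure S 0 F.
  move=> s; have [cW _] := WP s.
  by apply/countableU/cW/countableU/countable_range/countableU.
exists C; split.
- by split=> // x Ax; apply: (CF [::]) => //; do 3!left.
- split=> [|x y Cx Cy].
    by apply: (CF [::]) => //; left; left; right; rewrite /= big_nil.
  apply: (CF [:: x; y]); last by left; left; right; rewrite /= !big_cons big_nil addr0.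
  by move=> z; rewrite !inE => /orP[] /eqP->.
- move=> x Cx; have [uS ux] := uP x.
  apply: way_below_seq_approximable uS ux => m.
  apply: (CF [:: x]); last by left; right; exists m.
  by move=> z; rewrite !inE => /eqP->.
- move=> x' x r y Cx' Cx Cy x'x xy.
  have [_ /(_ _ _ _ _ erefl x'x xy)[z Wz zP]] := WP [:: x', x & codom y].
  exists z => // j k; apply: (CF [:: x', x & codom y]); last by right.
  by move=> t; rewrite !inE => /or3P[/eqP->|/eqP->|/codomP[i ->]].
Qed.

(** * The sub-Cu-semigroup spanned by a countable core *)

Section Span.
Variables (S : pomType) (hS : cu_semigroup S) (C : set S).
Hypotheses (C0 : C 0) (CD : forall x y, C x -> C y -> C (x + y)).
Hypothesis C_approx : forall x, C x -> approximable C x.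

Definition span : {pred S} := [pred x | `[< approximable C x >]].

(** By [approximable_sum], an element way below [x + y] is way below a sum of
    two elements of [C] that are way below [x] and [y]; that sum is in [C]. *)
Lemma span_addr_closed : Algebra.addumagma_closed span.
Proof.
split=> [|x y /asboolP Cx /asboolP Cy]; apply/asboolP; first exact: C_approx.
move=> s sxy.
have [//||b [Cb bxy sb]] := @approximable_sum S hS C 2
    (fun j => if j == ord0 then x else y) s.
- by move=> j; case: ifP.
- by rewrite !big_ord_recl big_ord0 addr0.
exists (b ord0 + b (lift ord0 ord0)); first exact: CD.
split; first by move: sb; rewrite !big_ord_recl big_ord0 addr0.
by apply: cu_O3.
Qed.

Definition span_submonoid : addrClosed S :=
  HB.pack span (GRing.isAddClosed.Build S span span_addr_closed).

Lemma mem_span x : (x \in span_submonoid) <-> approximable C x.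
Proof. by split=> /asboolP. Qed.

Lemma sub_span : C `<=` [set` span_submonoid].
Proof. by move=> x /C_approx/mem_span. Qed.

Lemma span_sub_cu_semigroup : sub_cu_semigroup span_submonoid.
Proof.
apply: sub_cu_semigroup_of_approximable => // [u s uinc Tu us|s /mem_span].
  by apply/mem_span; apply: approximable_sup uinc _ us => // n; apply/mem_span.
exact: sub_approximable sub_span.
Qed.

Lemma span_countably_based : countable C ->
  countably_based (submonoid span_submonoid).
Proof.
move=> /countable_injP[f f_inj]; exists (val @^-1` C).
  apply/countable_injP; exists (f \o val) => x y; rewrite !inE => Cx Cy fxy.
  by apply/val_inj/f_inj; rewrite ?inE.
move=> x' x /(sub_way_below _ _ span_sub_cu_semigroup).
have /mem_span Cx := valP x => /Cx[y Cy [x'y yx]].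
exists (Sub y (sub_span Cy)); first exact: Cy.
by split; apply/(sub_way_below _ _ span_sub_cu_semigroup).
Qed.

(** Given [x' ≪ x ≪ \sum_j y j] in the span, elements of [C] are inserted as
    [x' ≪ a' ≪ a ≪ x] and [b j ≪ y j], with [x ≪ \sum_j b j]. Witnesses in [C]
    for [a'], [a] and [b] are then witnesses for [x'], [x] and [y]. *)
Lemma span_dim_le n : dim_le_on C n ->
  dim_le (submonoid span_submonoid) n.
Proof.
have hT := span_sub_cu_semigroup.
move=> dimC x' x r y /(sub_way_below _ _ hT) x'x /(sub_way_below _ _ hT).
rewrite val_sum => xy.
have /mem_span Cx := valP x.
have [a Ca [x'a ax]] := Cx _ x'x.
have [a' Ca' [x'a' a'a]] := C_approx Ca x'a.
have Cy j : approximable C (val (y j)) by apply/mem_span; exact: valP.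
have [b [Cb byj xb]] := approximable_sum hS Cy xy.
have [|z Cz [zb a'z za]] := dimC a' a r b Ca' Ca Cb a'a.
  exact: way_below_trans ax xb.
exists (fun j k => Sub (z j k) (sub_span (Cz j k))); split=> [j k||k];
  apply/(sub_way_below _ _ hT).
- exact: way_below_trans (zb j k) (byj j).
- rewrite val_sum; under eq_bigr do rewrite val_sum.
  exact: way_below_trans x'a' a'z.
- by rewrite val_sum; exact: way_below_trans (za k) ax.
Qed.

End Span.

Theorem theorem4 (S : pomType)
    (hS : cu_semigroup S) (n : nat) :
  [<-> dim_le S n;
       forall A : set S, finite_set A ->
         exists T : addrClosed S,
           [/\ sub_cu_semigroup T, countably_based (submonoid T),
               A `<=` [set` T] & dim_le (submonoid T) n];
       forall A : set S, countable A ->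
         exists T : addrClosed S,
           [/\ sub_cu_semigroup T, countably_based (submonoid T),
               A `<=` [set` T] & dim_le (submonoid T) n]].
Proof.
have countable_of_dim : dim_le S n -> forall A : set S, countable A ->
    exists T : addrClosed S,
      [/\ sub_cu_semigroup T, countably_based (submonoid T),
          A `<=` [set` T] & dim_le (submonoid T) n].
  move=> dimS A /(countable_core hS dimS)[C [[cC AC] [C0 CD] C_approx dimC]].
  pose T : addrClosed S := span_submonoid hS C0 CD C_approx.
  exists T; split.
  - exact: span_sub_cu_semigroup.
  - exact: span_countably_based.
  - by move=> x /AC; exact: sub_span.
  - exact: span_dim_le.
tfae=> [dimS A /finite_set_countable|/dim_le_of_sub //|subS].
  exact: countable_of_dim.
by apply: dim_le_of_sub => A /finite_set_countable/subS.
Qed.
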